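(* Let $A$ and $B$ be $\sigma$-sets such that there exist $A^{\ast}$ and $B^{\ast}$, the $\sigma$-antisets of $A$ and $B$, and let $f:A\rightarrow B$ be a bijective $\sigma$-function. Then there exists a unique $\sigma$-function $f_{-1^{\ast}}:B^{\ast}\rightarrow A^{\ast}$ (called the antinverse of $f$) such that for all $x\in A$ we have $f_{-1^{\ast}}(f^{\ast}(x))=x^{\ast}$, where $f^{\ast}:A\rightarrow B^{\ast}$ is the $\sigma$-antifunction of $f$.
   Context: Background. We work in $\sigma$-Set Theory (I. Gatica), a first-order theory whose objects considered here are $\sigma$-sets, with a membership relation $\in$ (''is a $\sigma$-element of''). The following are axioms, conventions or previously known basic facts of the theory. (1) Extensionality: $\sigma$-sets with the same $\sigma$-elements are equal. There is an empty $\sigma$-set $\emptyset$; for every $X$ there is the singleton $\{X\}$; for a $\sigma$-set $A$ and a formula $\varphi$, $\{x\in A:\varphi(x)\}$ is a $\sigma$-set. (2) Pair: for all $X,Y$ the fusion of pairs $\{X\}\cup\{Y\}$ is a $\sigma$-set which is either equal to $\{X,Y\}$ (the $\sigma$-set with exactly the $\sigma$-elements $X$ and $Y$) or equal to $\emptyset$; which of the two alternatives holds is decided by further axioms of the theory. (3) Exclusion: if $Y,Z\in X$ then $\{Y\}\cup\{Z\}=\{Y,Z\}$. (4) $\{\emptyset\}\cup\{A\}=\{\emptyset,A\}$ for every $A$. (5) Power: for every $X$ there is a $\sigma$-set $2^{X}$ whose $\sigma$-elements are exactly the $\sigma$-subsets of $X$. (6) If $\{X\}\cup\{Y\}=\emptyset$,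 then $Y$ is called the $\sigma$-antielement of $X$; this relation is symmetric, and the $\sigma$-antielement of $X$, if it exists, is unique and denoted $X^{\ast}$. Thus $(X^{\ast})^{\ast}=X$. Fusion. For $\sigma$-sets $A,B$ put $A\,\widehat{\cap}\,B=\{x\in A: x^{\ast}\in B\}$ (those $x\in A$ whose $\sigma$-antielement exists and lies in $B$), $A\divideontimes B=A-(A\,\widehat{\cap}\,B)$ (where $A-B=\{x\in A:x\notin B\}$), and define the fusion $A\cup B=\{x: x\in A\divideontimes B\ \vee\ x\in B\divideontimes A\}$, which agrees with (2) on singletons. For all $A,B$ there is a $\sigma$-set $\langle 2^{A},2^{B}\rangle=\{x\cup y: x\in 2^{A}\wedge y\in 2^{B}\}$. If $A\cup B=\emptyset$, then $B$ is called the $\sigma$-antiset of $A$; if it exists it is unique and is denoted $A^{\ast}$. Functions. The ordered pair is $(x,y):=\{\{x\}\}\cup\{\{x\}\cup\{y\}\}$, and $A\times B=\{(x,y):x\in A\wedge y\in B\}$, a $\sigma$-set contained in $2^{\langle 2^{A},2^{B}\rangle}$. A $\sigma$-function $f:A\rightarrow B$ is a $\sigma$-subset $f$ of $A\times B$ such that for all $x\in A$ there is a unique $y\in B$ with $(x,y)\in f$; this $y$ is denoted $f(x)$. Its range is $ran(f)=\{y\in B:(\exists x\in A)(f(x)=y)\}$. Two $\sigma$-functions with the same domain $A$ (possibly different codomains) are equal iff they take the same value at every $x\in A$. $f:A\rightarrow B$ is onto $B$ iff $ran(f)=B$, one-one iff $x\neq y$ implies $f(x)\neq f(y)$ for all $x,y\in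 A$, and bijective iff it is both. Antifunctions. If $f:A\rightarrow B$ and $f^{\ast}:A\rightarrow C$ are $\sigma$-functions, then $f^{\ast}$ is the $\sigma$-antifunction of $f$ if for all $x\in A$ we have $\{f(x)\}\cup\{f^{\ast}(x)\}=\emptyset$. When the $\sigma$-antiset $B^{\ast}$ exists, the $\sigma$-antifunction $f^{\ast}:A\rightarrow B^{\ast}$ of $f:A\rightarrow B$ exists and is given by $f^{\ast}(x)=(f(x))^{\ast}$. *)

(* Defs.v *)
From Stdlib Require Import ClassicalEpsilon.

Set Implicit Arguments.
Unset Strict Implicit.
Unset Printing Implicit Defensive.

Declare Scope sigma_scope.
Delimit Scope sigma_scope with sigma.
Local Open Scope sigma_scope.

(* A structure for the language of sigma-set theory.  [cup] is the fusion, a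
   primitive operation because the notion of antielement, in terms of which the
   fusion of arbitrary sigma-sets is described, is itself the equation
   {X} cup {Y} = empty. *)
Record sigma_structure : Type := SigmaStructure {
  carrier :> Type;
  mem : carrier -> carrier -> Prop;
  empty : carrier;
  sing : carrier -> carrier;
  cup : carrier -> carrier -> carrier
}.

Arguments mem {s} _ _.
Arguments empty {s}.
Arguments sing {s} _.
Arguments cup {s} _ _.

Notation "x ∈ A" := (mem x A) (at level 70, no associativity) : sigma_scope.
Notation "x ∉ A" := (~ mem x A) (at level 70, no associativity) : sigma_scope.
Notation "∅" := empty : sigma_scope.
Notation "{[ x ]}" := (sing x) (format "{[ x ]}") : sigma_scope.
Notation "A ∪ B" := (cup A B) (at level 50, left associativity) : sigma_scope.

(* First-order formulas, with de Bruijn indices; they are only used to state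
   separation as the first-order schema it is, rather than for arbitrary
   predicates of the metatheory. *)
Inductive term : Type :=
| t_var (n : nat)
| t_empty
| t_sing (t : term)
| t_cup (t u : term).

Inductive formula : Type :=
| f_mem (t u : term)
| f_eq (t u : term)
| f_false
| f_and (p q : formula)
| f_or (p q : formula)
| f_imp (p q : formula)
| f_all (p : formula)
| f_ex (p : formula).

Definition push (S : sigma_structure) (a : S) (e : nat -> S) : nat -> S :=
  fun n => match n with O => a | Datatypes.S m => e m end.

Fixpoint eval (S : sigma_structure) (e : nat -> S) (t : term) : S :=
  match t with
  | t_var n => e n
  | t_empty => ∅
  | t_sing t => {[eval e t]}
  | t_cup t u => eval e t ∪ eval e u
  end.

Fixpoint sat (S : sigma_structure) (e : nat -> S) (p : formula) : Prop :=
  match p with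
  | f_mem t u => eval e t ∈ eval e u
  | f_eq t u => eval e t = eval e u
  | f_false => False
  | f_and p q => sat e p /\ sat e q
  | f_or p q => sat e p \/ sat e q
  | f_imp p q => sat e p -> sat e q
  | f_all p => forall a : S, sat (push a e) p
  | f_ex p => exists a : S, sat (push a e) p
  end.

Section Notions.

Variable S : sigma_structure.
Implicit Types (x y z p A B C X Y f g : S).

Definition subset A B : Prop := forall z, z ∈ A -> z ∈ B.

Definition is_pair Z X Y : Prop := forall z, z ∈ Z <-> z = X \/ z = Y.

(* "The [a] such that [P a]"; meaningful only when there is exactly one. *)
Definition the (P : S -> Prop) : S := epsilon (inhabits ∅) P.

(* {z : P z}; meaningful only when that class is a sigma-set. *)
Definition compr (P : S -> Prop) : S :=
  the (fun A => forall z, z ∈ A <-> P z).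

Definition antielement X Y : Prop := {[X]} ∪ {[Y]} = ∅.

Definition star X : S := the (antielement X).

Definition diff A B : S := compr (fun z => z ∈ A /\ z ∉ B).

Definition hat_cap A B : S :=
  compr (fun x => x ∈ A /\ exists y, antielement x y /\ y ∈ B).

Definition divtimes A B : S := diff A (hat_cap A B).

Definition is_antiset A B : Prop := A ∪ B = ∅.

Definition has_antiset A : Prop := exists B, is_antiset A B.

Definition antiset A : S := the (is_antiset A).

Definition opair x y : S := {[{[x]}]} ∪ {[{[x]} ∪ {[y]}]}.

Definition times A B : S :=
  compr (fun p => exists x y, x ∈ A /\ y ∈ B /\ p = opair x y).

Definition sigma_function A B f : Prop :=
  subset f (times A B) /\
  forall x, x ∈ A -> exists! y, y ∈ B /\ opair x y ∈ f.

Definition app f x : S := the (fun y => opair x y ∈ f).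

Definition ran A B f : S :=
  compr (fun y => y ∈ B /\ exists x, x ∈ A /\ app f x = y).

Definition onto A B f : Prop := ran A B f = B.

Definition one_one A f : Prop :=
  forall x y, x ∈ A -> y ∈ A -> x <> y -> app f x <> app f y.

Definition bijective_function A B f : Prop :=
  sigma_function A B f /\ onto A B f /\ one_one A f.

Definition is_antifunction A B C f g : Prop :=
  sigma_function A B f /\ sigma_function A C g /\
  forall x, x ∈ A -> {[app f x]} ∪ {[app g x]} = ∅.

Definition antifunction A B f : S :=
  the (is_antifunction A B (antiset B) f).

(* The existence of <2^A, 2^B> for all A and B is deliberately not an axiom:
   it is only needed for A × B to be a sigma-set, which [ax_times] asks for
   directly, and if [antielement X Y] then <2^X, 2^Y> has the sigma-elements
   X = X ∪ ∅ and Y = ∅ ∪ Y, against [ax_exclusion].  Assuming it would thus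
   leave no antielements, and no nonempty sigma-set with an antiset. *)
Record sigma_axioms : Prop := SigmaAxioms {
  ax_extensionality : forall A B, (forall z, z ∈ A <-> z ∈ B) -> A = B;
  ax_empty : forall z, z ∉ ∅;
  ax_singleton : forall X z, z ∈ {[X]} <-> z = X;
  ax_separation : forall A (phi : formula) (e : nat -> S),
    exists B, forall x, x ∈ B <-> x ∈ A /\ sat (push x e) phi;
  ax_pair : forall X Y,
    is_pair ({[X]} ∪ {[Y]}) X Y \/ {[X]} ∪ {[Y]} = ∅;
  ax_exclusion : forall X Y Z,
    Y ∈ X -> Z ∈ X -> is_pair ({[Y]} ∪ {[Z]}) Y Z;
  ax_empty_pair : forall A, is_pair ({[∅]} ∪ {[A]}) ∅ A;
  ax_power : forall X, exists P, forall Y, Y ∈ P <-> subset Y X;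
  ax_antielement_sym : forall X Y, antielement X Y -> antielement Y X;
  ax_antielement_uniq : forall X Y Z,
    antielement X Y -> antielement X Z -> Y = Z;
  ax_fusion : forall A B x,
    x ∈ A ∪ B <-> x ∈ divtimes A B \/ x ∈ divtimes B A;
  ax_times : forall A B, exists P, forall p,
    p ∈ P <-> exists x y, x ∈ A /\ y ∈ B /\ p = opair x y
}.

End Notions.

(* Main.v *)
(** The antielement relation restricts to a bijection between a sigma-set and
its sigma-antiset, so the antinverse is the composite of [f^-1] with these
bijections: it sends [y^*] to [x^*] whenever [(x, y) ∈ f].  As [f] is onto [B],
every sigma-element of [B^*] is some [f^*(x)], whence uniqueness.  Ordered pairs
are injective although [{x} ∪ {y}] may collapse to [∅]: the sigma-elements
[{x}] and [{x} ∪ {y}] lie in a common power sigma-set, so by exclusion the outer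
fusion never collapses, and in the collapsed case [y] is recovered as [x^*]. *)

From Stdlib Require Import Classical ClassicalEpsilon.
Require Import Defs.

Local Open Scope sigma_scope.

(** Syntactic counterparts of [opair] and [antielement]. Evaluation turns them into these notions by
    computation, so instances of separation match the intended predicates by conversion. *)
Definition opair_term (t u : term) : term :=
  t_cup (t_sing (t_sing t)) (t_sing (t_cup (t_sing t) (t_sing u))).

Definition antielement_formula (t u : term) : formula :=
  f_eq (t_cup (t_sing t) (t_sing u)) t_empty.

Section Antinverse.

Context {S : sigma_structure} (HS : sigma_axioms S).
Implicit Types (x y z w p u v A B C f g : S).

Lemma the_spec (P : S -> Prop) : (exists x, P x) -> P (the P).
Proof. apply epsilon_spec. Qed.

Lemma the_eq (P : S -> Prop) x : P x -> (forall y, P y -> y = x) -> the P = x.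
Proof. intros Hx Hu. apply Hu, the_spec. now exists x. Qed.

Lemma mem_compr (P : S -> Prop) :
  (exists A, forall z, z ∈ A <-> P z) -> forall z, z ∈ compr P <-> P z.
Proof. exact (the_spec (fun A => forall z, z ∈ A <-> P z)). Qed.

(** * Fusion and antisets *)

Lemma mem_hat_cap A B x :
  x ∈ hat_cap A B <-> x ∈ A /\ exists y, antielement x y /\ y ∈ B.
Proof.
  revert x. apply mem_compr.
  exact (ax_separation HS A
    (f_ex (f_and (antielement_formula (t_var 1) (t_var 0))
                 (f_mem (t_var 0) (t_var 2)))) (fun _ => B)).
Qed.

Lemma mem_diff A B x : x ∈ diff A B <-> x ∈ A /\ x ∉ B.
Proof.
  revert x. apply mem_compr.
  exact (ax_separation HS A
    (f_imp (f_mem (t_var 0) (t_var 1)) f_false) (fun _ => B)).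
Qed.

Lemma mem_divtimes A B x :
  x ∈ divtimes A B <-> x ∈ A /\ ~ exists y, antielement x y /\ y ∈ B.
Proof. unfold divtimes. rewrite mem_diff, mem_hat_cap. tauto. Qed.

(** A fusion is empty exactly when both [divtimes] parts are; classically, this says that every
    sigma-element on either side is cancelled by an antielement on the other. *)
Lemma antiset_iff A B :
  is_antiset A B <->
  (forall x, x ∈ A -> exists y, antielement x y /\ y ∈ B) /\
  (forall y, y ∈ B -> exists x, antielement y x /\ x ∈ A).
Proof.
  split.
  - intros H.
    assert (HE : forall x, ~ (x ∈ divtimes A B \/ x ∈ divtimes B A)).
    { intros x Hx. apply (ax_fusion HS) in Hx. rewrite H in Hx.
      exact (ax_empty HS Hx). }
    split; intros x Hx; apply NNPP; intros Hn; apply (HE x);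
      [left | right]; apply mem_divtimes; tauto.
  - intros [HAB HBA]. apply (ax_extensionality HS). intros x.
    rewrite (ax_fusion HS), !mem_divtimes.
    split; [| intros Hx; destruct (ax_empty HS Hx)].
    intros [[Hx Hn] | [Hx Hn]]; destruct Hn; auto.
Qed.

Lemma mem_antiset A y :
  has_antiset A -> y ∈ antiset A <-> exists x, x ∈ A /\ antielement x y.
Proof.
  intros hA.
  destruct (proj1 (antiset_iff _ _) (the_spec (is_antiset A) hA)) as [H1 H2].
  split.
  - intros Hy. destruct (H2 y Hy) as (x & Hxy & Hx).
    exists x. split; [exact Hx | now apply (ax_antielement_sym HS)].
  - intros (x & Hx & Hxy). destruct (H1 x Hx) as (z & Hxz & Hz).
    now rewrite (ax_antielement_uniq HS Hxy Hxz).
Qed.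

Lemma antielement_in_antiset A x :
  has_antiset A -> x ∈ A -> exists y, antielement x y /\ y ∈ antiset A.
Proof.
  intros hA Hx.
  now apply (proj1 (antiset_iff _ _) (the_spec (is_antiset A) hA)).
Qed.

Lemma antielement_uniq_l x y z : antielement x z -> antielement y z -> x = y.
Proof.
  intros Hx Hy. apply (ax_antielement_uniq HS (X := z));
    now apply (ax_antielement_sym HS).
Qed.

Lemma star_eq x y : antielement x y -> star x = y.
Proof.
  intros H. apply the_eq; [exact H |].
  intros z Hz. exact (ax_antielement_uniq HS Hz H).
Qed.

(** * Ordered pairs *)

Lemma sing_inj x y : {[x]} = {[y]} -> x = y.
Proof. intros H. apply (ax_singleton HS). rewrite <- H. now apply (ax_singleton HS). Qed.

Lemma sing_neq_empty x : {[x]} <> ∅.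
Proof.
  intros H. apply (ax_empty HS (z := x)). rewrite <- H.
  now apply (ax_singleton HS).
Qed.

Lemma pair_of_subsets u v w :
  subset u w -> subset v w -> is_pair ({[u]} ∪ {[v]}) u v.
Proof.
  intros Hu Hv. destruct (ax_power HS w) as [P HP].
  apply (ax_exclusion HS (X := P)); now apply HP.
Qed.

(** The common superset of both components is [{[x]} ∪ {[y]}] when that fusion is a genuine pair,
    and [{[x]}] when it collapses to [∅]. *)
Lemma mem_opair x y z : z ∈ opair x y <-> z = {[x]} \/ z = {[x]} ∪ {[y]}.
Proof.
  revert z.
  destruct (ax_pair HS x y) as [H | H].
  - apply (pair_of_subsets _ _ ({[x]} ∪ {[y]})); intros z Hz; [| exact Hz].
    apply H. left. now apply (ax_singleton HS).
  - apply (pair_of_subsets _ _ {[x]}); intros z Hz; [exact Hz |].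
    rewrite H in Hz. destruct (ax_empty HS Hz).
Qed.

Lemma cup_sing_eq_sing x y z : {[x]} ∪ {[y]} = {[z]} -> x = z /\ y = z.
Proof.
  intros H. destruct (ax_pair HS x y) as [Hp | Hp].
  - split; apply (ax_singleton HS); rewrite <- H; apply Hp; auto.
  - rewrite Hp in H. symmetry in H. destruct (sing_neq_empty _ H).
Qed.

Lemma cup_sing_inj_r x y y' :
  {[x]} ∪ {[y]} = {[x]} ∪ {[y']} -> y = y'.
Proof.
  intros H.
  destruct (ax_pair HS x y) as [Hp | Hp], (ax_pair HS x y') as [Hp' | Hp'].
  (* Both fusions are genuine pairs; if [y] is not directly [y'], then both equal [x]. *)
  - assert (H1 : y = x \/ y = y')
      by (apply Hp'; rewrite <- H; apply Hp; auto).
    assert (H2 : y' = x \/ y' = y)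
      by (apply Hp; rewrite H; apply Hp'; auto).
    destruct H1, H2; congruence.
  (* If just one fusion collapsed, [x] would be a sigma-element of [∅]. *)
  - destruct (ax_empty HS (z := x)). rewrite <- Hp', <- H. apply Hp. auto.
  - destruct (ax_empty HS (z := x)). rewrite <- Hp, H. apply Hp'. auto.
  - exact (ax_antielement_uniq HS Hp Hp').
Qed.

Lemma opair_inj x y x' y' : opair x y = opair x' y' -> x = x' /\ y = y'.
Proof.
  intros H.
  assert (Hm : forall z, (z = {[x]} \/ z = {[x]} ∪ {[y]}) <->
                         (z = {[x']} \/ z = {[x']} ∪ {[y']}))
    by (intros z; rewrite <- !mem_opair, H; tauto).
  assert (Hx : x = x').
  { destruct (proj1 (Hm {[x]}) (or_introl eq_refl)) as [E | E].
    - now apply sing_inj.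
    - symmetry in E. apply cup_sing_eq_sing in E. now destruct E. }
  subst x'. split; [reflexivity |]. apply (cup_sing_inj_r x).
  (* The fusion with [y] may itself be [{[x]}]; the converse inclusion then forces the fusion with
     [y'] to be [{[x]}] too, or to equal the fusion with [y]. *)
  destruct (proj1 (Hm ({[x]} ∪ {[y]})) (or_intror eq_refl)) as [E | E];
    [| exact E].
  destruct (proj2 (Hm ({[x]} ∪ {[y']})) (or_intror eq_refl)) as [E' | E'];
    congruence.
Qed.

(** * Products and sigma-functions *)

Lemma mem_times A B p :
  p ∈ times A B <-> exists x y, x ∈ A /\ y ∈ B /\ p = opair x y.
Proof. revert p. apply mem_compr, (ax_times HS). Qed.

Lemma opair_mem_function A B f x y :
  sigma_function A B f -> opair x y ∈ f -> x ∈ A /\ y ∈ B.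
Proof.
  intros [Hf _] H. apply Hf, mem_times in H.
  destruct H as (x' & y' & Hx & Hy & E). apply opair_inj in E.
  destruct E. now subst.
Qed.

Lemma app_spec A B f x :
  sigma_function A B f -> x ∈ A -> opair x (app f x) ∈ f.
Proof.
  intros [_ Hf] Hx. apply (the_spec (fun y => opair x y ∈ f)).
  destruct (Hf x Hx) as (y & [_ Hy] & _). now exists y.
Qed.

Lemma app_in A B f x : sigma_function A B f -> x ∈ A -> app f x ∈ B.
Proof.
  intros Hf Hx. exact (proj2 (opair_mem_function _ _ _ _ _ Hf (app_spec _ _ _ _ Hf Hx))).
Qed.

Lemma app_eq A B f x y : sigma_function A B f -> opair x y ∈ f -> app f x = y.
Proof.
  intros Hf H. destruct (opair_mem_function _ _ _ _ _ Hf H) as [Hx Hy].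
  pose proof (app_spec _ _ _ _ Hf Hx) as H'. pose proof (app_in _ _ _ _ Hf Hx) as Hy'.
  destruct Hf as [_ Hf]. destruct (Hf x Hx) as (z & _ & Hz).
  transitivity z; [symmetry |]; apply Hz; auto.
Qed.

Lemma function_ext A B f g :
  sigma_function A B f -> sigma_function A B g ->
  (forall x, x ∈ A -> app f x = app g x) -> f = g.
Proof.
  assert (Hsub : forall f g, sigma_function A B f -> sigma_function A B g ->
    (forall x, x ∈ A -> app f x = app g x) -> subset f g).
  { clear f g. intros f g Hf Hg E p Hp.
    pose proof (proj1 Hf p Hp) as Ht. apply mem_times in Ht.
    destruct Ht as (x & y & Hx & _ & ->).
    rewrite <- (app_eq _ _ _ _ _ Hf Hp), (E x Hx).
    exact (app_spec _ _ _ _ Hg Hx). }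
  intros Hf Hg E. apply (ax_extensionality HS). intros p. split.
  - now apply Hsub.
  - apply Hsub; auto. intros x Hx. symmetry. now apply E.
Qed.

(* The variables of [phi] are 0 for the value, 1 for the argument, 2 for the
   pair of both, and [n + 3] for the parameter [e n]. *)
Lemma function_of_graph A B (R : S -> S -> Prop) (phi : formula) (e : nat -> S) :
  (forall p x y, sat (push y (push x (push p e))) phi <-> R x y) ->
  (forall x, x ∈ A -> exists! y, y ∈ B /\ R x y) ->
  exists g, sigma_function A B g /\ forall x, x ∈ A -> R x (app g x).
Proof.
  intros Hphi HR.
  destruct (ax_separation HS (times A B)
    (f_ex (f_ex (f_and (f_eq (t_var 2) (opair_term (t_var 1) (t_var 0))) phi)))
    e) as [g Hg].
  assert (Hmem : forall x y, opair x y ∈ g <-> x ∈ A /\ y ∈ B /\ R x y).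
  { intros x y. rewrite Hg, mem_times. simpl. split.
    - intros [(x1 & y1 & Hx & Hy & E1) (x2 & y2 & E2 & H)].
      apply opair_inj in E1, E2. destruct E1, E2. subst x1 y1 x2 y2.
      apply Hphi in H. auto.
    - intros (Hx & Hy & H). split.
      + now exists x, y.
      + exists x, y. split; [reflexivity | now apply Hphi]. }
  assert (Hfun : sigma_function A B g).
  { split.
    - intros p Hp. now apply Hg.
    - intros x Hx. destruct (HR x Hx) as (y & [Hy H] & Hu).
      exists y. split.
      + split; [exact Hy | now apply Hmem].
      + intros y' [Hy' H']. apply Hu. apply Hmem in H'. tauto. }
  exists g. split; [exact Hfun |].
  intros x Hx. apply Hmem. exact (app_spec _ _ _ _ Hfun Hx).
Qed.

(** * Antifunctions *)

(** [antifunction] is defined by description, so a witness is required before its defining property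
    can be used. *)
Lemma antifunction_exists A B f :
  has_antiset B -> sigma_function A B f ->
  exists g, is_antifunction A B (antiset B) f g.
Proof.
  intros hB Hf.
  destruct (function_of_graph A (antiset B)
    (fun x z => exists y, opair x y ∈ f /\ antielement y z)
    (* Under the extra quantifier, 0 is [y], 1 the value [z], 2 the argument [x], and 4 the
       parameter [f]. *)
    (f_ex (f_and (f_mem (opair_term (t_var 2) (t_var 0)) (t_var 4))
                 (antielement_formula (t_var 0) (t_var 1)))) (fun _ => f))
    as (g & Hg & Happ).
  - intros p x z. reflexivity.
  - intros x Hx. pose proof (app_spec _ _ _ _ Hf Hx) as Hp.
    destruct (antielement_in_antiset _ _ hB (app_in _ _ _ _ Hf Hx)) as (z & Hz & HzB).
    exists z. split.
    + split; [exact HzB |]. now exists (app f x).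
    + intros z' (_ & y & Hy & Hz'). rewrite <- (app_eq _ _ _ _ _ Hf Hy) in Hz'.
      exact (ax_antielement_uniq HS Hz Hz').
  - exists g. split; [exact Hf | split; [exact Hg |]]. intros x Hx.
    destruct (Happ x Hx) as (y & Hy & Hyz). now rewrite (app_eq _ _ _ _ _ Hf Hy).
Qed.

Lemma antielement_app_antifunction A B f x :
  has_antiset B -> sigma_function A B f -> x ∈ A ->
  antielement (app f x) (app (antifunction A B f) x).
Proof.
  intros hB Hf Hx.
  exact (proj2 (proj2 (the_spec _ (antifunction_exists _ _ _ hB Hf))) x Hx).
Qed.

Lemma onto_preimage A B f y :
  sigma_function A B f -> onto A B f -> y ∈ B -> exists x, x ∈ A /\ app f x = y.
Proof.
  intros Hf Ho Hy.
  assert (Hr : forall z, z ∈ ran A B f <-> z ∈ B /\ exists x, x ∈ A /\ app f x = z).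
  { apply mem_compr.
    (* [app] is not a term of the language, so the range is separated through pairs in [f] and
       translated afterwards. *)
    destruct (ax_separation HS B
      (f_ex (f_mem (opair_term (t_var 0) (t_var 1)) (t_var 2))) (fun _ => f))
      as [C HC].
    exists C. intros z. rewrite HC. simpl. split.
    - intros [Hz [x Hx]]. split; [exact Hz |]. exists x. split.
      + exact (proj1 (opair_mem_function _ _ _ _ _ Hf Hx)).
      + exact (app_eq _ _ _ _ _ Hf Hx).
    - intros [Hz (x & Hx & E)]. split; [exact Hz |]. exists x.
      rewrite <- E. exact (app_spec _ _ _ _ Hf Hx). }
  rewrite <- Ho in Hy. now apply Hr.
Qed.

(** Write [z] as an antielement of some [app f x]; the antifunction at [x] is another one, so the
    two coincide. *)
Lemma antiset_eq_antifunction A B f z :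
  has_antiset B -> sigma_function A B f -> onto A B f -> z ∈ antiset B ->
  exists x, x ∈ A /\ app (antifunction A B f) x = z.
Proof.
  intros hB Hf Ho Hz. apply (mem_antiset _ _ hB) in Hz.
  destruct Hz as (y & Hy & Hyz).
  destruct (onto_preimage _ _ _ _ Hf Ho Hy) as (x & Hx & <-).
  exists x. split; [exact Hx |].
  exact (ax_antielement_uniq HS (antielement_app_antifunction _ _ _ _ hB Hf Hx) Hyz).
Qed.

(** * The antinverse *)

Lemma antinverse_exists A B f :
  has_antiset A -> has_antiset B -> bijective_function A B f ->
  exists g, sigma_function (antiset B) (antiset A) g /\
    forall x, x ∈ A -> app g (app (antifunction A B f) x) = star x.
Proof.
  intros hA hB (Hf & Ho & Hinj).
  (* Antielements determine each other and [f] is one-one, so a point of the antiset of [B] comes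
     from only one [x]. This makes the graph below single-valued. *)
  assert (Hinj' : forall x x' z, opair x (app f x) ∈ f -> opair x' (app f x') ∈ f ->
    antielement (app f x) z -> antielement (app f x') z -> x = x').
  { intros x x' z Hx Hx' H H'. apply NNPP. intros Hne.
    apply (Hinj x x'); auto.
    - exact (proj1 (opair_mem_function _ _ _ _ _ Hf Hx)).
    - exact (proj1 (opair_mem_function _ _ _ _ _ Hf Hx')).
    - exact (antielement_uniq_l _ _ _ H H'). }
  destruct (function_of_graph (antiset B) (antiset A)
    (fun z w => exists x y, opair x y ∈ f /\ antielement y z /\ antielement x w)
    (* Here 0 is [y], 1 is [x], 2 the value [w], 3 the argument [z], and 5 the parameter [f]. *)
    (f_ex (f_ex (f_and (f_mem (opair_term (t_var 1) (t_var 0)) (t_var 5))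
      (f_and (antielement_formula (t_var 0) (t_var 3))
             (antielement_formula (t_var 1) (t_var 2)))))) (fun _ => f))
    as (g & Hg & Happ).
  - intros p z w. reflexivity.
  - intros z Hz.
    destruct (antiset_eq_antifunction _ _ _ _ hB Hf Ho Hz) as (x & Hx & <-).
    destruct (antielement_in_antiset _ _ hA Hx) as (w & Hw & HwA).
    pose proof (antielement_app_antifunction _ _ _ _ hB Hf Hx) as Hfx.
    pose proof (app_spec _ _ _ _ Hf Hx) as Hxf.
    exists w. split.
    + split; [exact HwA |]. now exists x, (app f x).
    + intros w' (_ & x' & y' & Hp & Hy & Hw').
      pose proof (app_eq _ _ _ _ _ Hf Hp) as E. subst y'.
      rewrite <- (Hinj' _ _ _ Hxf Hp Hfx Hy) in Hw'.
      exact (ax_antielement_uniq HS Hw Hw').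
  - exists g. split; [exact Hg |]. intros x Hx. symmetry. apply star_eq.
    pose proof (antielement_app_antifunction _ _ _ _ hB Hf Hx) as Hfx.
    (* The graph supplies only some preimage [x']; [Hinj'] identifies it with [x]. *)
    destruct (Happ (app (antifunction A B f) x)) as (x' & y' & Hp & Hy & Hw).
    { apply (mem_antiset _ _ hB). exists (app f x). split; [| exact Hfx].
      exact (app_in _ _ _ _ Hf Hx). }
    pose proof (app_eq _ _ _ _ _ Hf Hp) as E. subst y'.
    now rewrite <- (Hinj' _ _ _ (app_spec _ _ _ _ Hf Hx) Hp Hfx Hy) in Hw.
Qed.

End Antinverse.

Theorem theorem3p15 (S : sigma_structure) (HS : sigma_axioms S) (A B f : S)
    (hA : has_antiset A) (hB : has_antiset B)
    (hf : bijective_function A B f) :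
  exists! g : S,
    sigma_function (antiset B) (antiset A) g /\
    forall x : S, x ∈ A -> app g (app (antifunction A B f) x) = star x.
Proof.
  destruct (antinverse_exists HS A B f hA hB hf) as (g & Hg & Happ).
  exists g. split; [now split |].
  intros h [Hh Happ']. apply (function_ext HS _ _ _ _ Hg Hh).
  destruct hf as (Hf & Ho & _). intros z Hz.
  destruct (antiset_eq_antifunction HS _ _ _ _ hB Hf Ho Hz) as (x & Hx & <-).
  now rewrite Happ, Happ'.
Qed.
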